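(* Let $\mathcal{A}=(a_i)_{i=1}^\infty$ be a strictly increasing sequence of positive integers such that $\gcd(a_1,a_2)=1$, and let $k\geqslant 3$ be an integer. Then for all integers $a,b\geqslant 2(k-1)!\prod_{i=1}^k a_i+2$ we have $$p_{\mathcal{A}}(a,k)\,p_{\mathcal{A}}(b,k)>p_{\mathcal{A}}(a+b,k).$$
   Context: For a sequence $\mathcal{A}=(a_i)_{i=1}^\infty$ of positive integers, a positive integer $k$ and an integer $n\geqslant 0$, $p_{\mathcal{A}}(n,k)$ denotes the number of partitions of $n$ with all parts in $\{a_1,\ldots,a_k\}$ (order of parts is irrelevant), i.e. $\sum_{n\geqslant 0}p_{\mathcal{A}}(n,k)x^n=\prod_{i=1}^k\frac{1}{1-x^{a_i}}$. In particular $p_{\mathcal{A}}(0,k)=1$, and $p_{\mathcal{A}}(n,k)=0$ for $n<0$. *)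

(* Defs.v *)
From mathcomp Require Import all_boot.

Set Implicit Arguments.
Unset Strict Implicit.
Unset Printing Implicit Defensive.

(* Sequences are indexed from 0: [A i] stands for a_{i+1}, so the allowed
   parts a_1, ..., a_k are [A 0, ..., A k.-1].
   A partition is given by its multiplicity vector: [m i] is the number of
   times the part [A i] is used, as in the coefficient of x^n in
   \prod_(i < k) (1 + x^(A i) + x^(2 * A i) + ...).  When all parts are
   positive, no multiplicity exceeds [n], so the bound [m i < n.+1] only
   serves to make the set finite. *)
Definition restricted_partitions (A : nat -> nat) (n k : nat)
    : {set {ffun 'I_k -> 'I_n.+1}} :=
  [set m : {ffun 'I_k -> 'I_n.+1} | \sum_(i < k) m i * A i == n].

Definition part_count (A : nat -> nat) (n k : nat) : nat :=
  #|restricted_partitions A n k|.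

(* Main.v *)
Require Import Defs.
From mathcomp Require Import all_boot.
From mathcomp Require Import all_algebra zify.
Import GRing.Theory.

(** Write p(n) for the number of partitions of n with parts A 0, ..., A (k - 1),
    P for the product of these parts, m for A 0 * A 1 and N for (k - 1)! * P.
    The count p behaves like n ^ (k - 1) / N, so p(a) p(b) exceeds p(a + b) as
    soon as a * b is large enough compared with N ^ (1 / (k - 1)) * (a + b).
    To make this effective, two explicit estimates are used:

      (n - m) ^ (k - 1) <= N * p(n) <= (n + P) ^ (k - 1),

    with truncated subtraction on the left ([part_count_ge],
    [part_count_le]).  For k = 2 coprimality says that among the numbers
    n, n - A 1, ..., n - (A 0 - 1) * A 1 exactly one is divisible by A 0, so
    p(n) = p(n - m) + 1, and p(n) is n / m up to an error of at most 1.  Each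
    further part h is added through the recurrence
    p'(n) = p(n) + p'(n - h), under which the estimates are propagated by the
    discrete form of integrating a power, [expn_step_upper] and
    [expn_step_lower].

    It remains to see that N * (a + b + P) ^ (k - 1) is smaller than
    ((a - m) (b - m)) ^ (k - 1).  If a <= b, then a + b + P is at most
    3 (b - m), while (a - m) / 3 is at least N / 2, whose square already
    exceeds N; this is where k >= 3 enters. *)

Set Implicit Arguments.
Unset Strict Implicit.
Unset Printing Implicit Defensive.

(** * Generating polynomial and recurrence on the last part *)

(** The factors are geometric series cut after B + 1 terms, which changes no
    coefficient of degree at most B: counting partitions by this polynomial
    frees the multiplicity bound from the number being partitioned. *)
Definition truncated_gf (A : nat -> nat) (B k : nat) : {poly nat} :=
  (\prod_(i < k) \sum_(j < B.+1) 'X^(j * A i))%R.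

Lemma coef_truncated_gfS A B k n :
  ((truncated_gf A B k.+1)`_n)%R =
  \sum_(j < B.+1 | j * A k <= n) ((truncated_gf A B k)`_(n - j * A k))%R.
Proof.
rewrite /truncated_gf big_ord_recr /= mulr_sumr coef_sum [RHS]big_mkcond /=.
by apply: eq_bigr => j _; rewrite coefMXn ltnNge; case: (_ <= _).
Qed.

Lemma coef_truncated_gf_bound A B k n : (forall i, 0 < A i) -> n <= B ->
  ((truncated_gf A B k)`_n = (truncated_gf A n k)`_n)%R.
Proof.
move=> A_pos; elim: k B n => [|k IHk] B n leB; first by rewrite /truncated_gf !big_ord0.
rewrite !coef_truncated_gfS.
rewrite -(big_mkord (fun j => j * A k <= n)
  (fun j => ((truncated_gf A n k)`_(n - j * A k))%R)).
rewrite (big_nat_widen _ _ B.+1) // big_mkord.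
apply: eq_big => [j|j lej].
  (* The multiplicity of a positive part is at most n, so the terms added by
     widening the range from n to B are excluded by the filter. *)
  apply/idP/andP => [lej|[]//]; split=> //=.
  by rewrite ltnS (leq_trans _ lej) // leq_pmulr.
by rewrite (IHk B) ?(IHk n (n - _)) ?leq_subr // (leq_trans (leq_subr _ _)).
Qed.

(** Expanding the product of sums yields one monomial for each choice of
    multiplicities, of degree the number that they partition. *)
Lemma coef_truncated_gf A n k :
  ((truncated_gf A n k)`_n)%R = part_count A n k.
Proof.
rewrite /truncated_gf bigA_distr_bigA /= coef_sum /part_count -sum1_card.
rewrite [RHS]big_mkcond /=; apply: eq_bigr => m _.
rewrite -(big_morph _ (exprD _) (expr0 _)) coefXn inE eq_sym.
by case: eqP.
Qed.

(** Either the part A k is absent, or one copy of it can be removed. *)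
Lemma part_countS A n k : (forall i, 0 < A i) ->
  part_count A n k.+1 =
    part_count A n k + (if A k <= n then part_count A (n - A k) k.+1 else 0).
Proof.
move=> A_pos; rewrite -!coef_truncated_gf.
have le1 : n - A k <= n by apply: leq_subr.
rewrite -(@coef_truncated_gf_bound A n k.+1) // !coef_truncated_gfS.
rewrite big_mkcond big_ord_recl mul0n subn0 /=.
congr (_ + _); case: leqP => [leA|gtA].
  (* The sum on the right has one more term, for multiplicity n, which would
     need n * A k <= n - A k. *)
  rewrite [RHS]big_mkcond big_ord_recr /= ifN; last first.
    rewrite -ltnNge (leq_trans _ (leq_pmulr n (A_pos k))) //.
    by rewrite ltn_subrL A_pos (leq_trans (A_pos k)).
  rewrite [RHS]addn0; apply: eq_bigr => j _.
  by rewrite /bump /= mulnDl mul1n leq_subRL // subnDA.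
apply: big1 => j _; rewrite /bump /= mulnDl mul1n ifN // -ltnNge.
exact: ltn_addr.
Qed.

Lemma part_count0 A n : part_count A n 0 = (n == 0).
Proof. by rewrite -coef_truncated_gf /truncated_gf big_ord0 coef1; case: eqP. Qed.

Lemma part_count1 A n : (forall i, 0 < A i) -> part_count A n 1 = (A 0 %| n).
Proof.
move=> A_pos; elim/ltn_ind: n => n IHn.
rewrite part_countS // part_count0; have A0 := A_pos 0.
have [->|n_gt0] := posnP n; first by rewrite leqNgt A0 dvdn0.
case: leqP => [leA|gtA]; last by rewrite gtnNdvd //; case: n n_gt0 {IHn gtA}.
by rewrite IHn ?ltn_subrL ?A0 // dvdn_subl //; case: n n_gt0 {IHn leA}.
Qed.

(** * Two coprime parts *)

(** The recurrence unrolled r times; for r = A 0 the sum runs over a full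
    system of residues modulo A 0. *)
Lemma part_count2_iter A n r : (forall i, 0 < A i) ->
  part_count A n 2 =
    \sum_(j < r | j * A 1 <= n) (A 0 %| n - j * A 1) +
    (if r * A 1 <= n then part_count A (n - r * A 1) 2 else 0).
Proof.
move=> A_pos; elim: r => [|r IHr]; first by rewrite big_ord0 subn0.
rewrite {}IHr [in RHS]big_mkcond big_ord_recr /= -big_mkcond -addnA.
congr (_ + _); rewrite mulSn; case: leqP => [le_r|gt_r]; last first.
  by rewrite ifN // -ltnNge ltn_addl.
by rewrite part_countS // part_count1 // leq_subRL // subnDA subnAC (addnC (r * A 1)).
Qed.

(** Two solutions j would differ by a multiple of u, as v is invertible
    modulo u. *)
Lemma sum_dvdn_sub_le1 u v n : coprime u v ->
  \sum_(j < u | j * v <= n) (u %| n - j * v) <= 1.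
Proof.
move=> co_uv.
have uniq (i j : 'I_u) : i * v <= n -> u %| n - i * v ->
    j * v <= n -> u %| n - j * v -> i = j.
  wlog le_ij : i j / i <= j.
    move=> W lei di lej dj; case/orP: (leq_total i j) => /W; first exact.
    by move=> ->.
  move=> lei di lej dj; apply: val_inj => /=.
  have : u %| (j - i) * v.
    have -> : (j - i) * v = (n - i * v) - (n - j * v).
      by rewrite mulnBl; have := leq_mul2r v i j; lia.
    exact: dvdn_sub.
  rewrite Gauss_dvdl // => /dvdn_leq; have := ltn_ord j; lia.
have [j /andP[lej dj]|none] :=
  pickP (fun j : 'I_u => (j * v <= n) && (u %| n - j * v)).
  rewrite (bigD1 j) //= dj big1 // => i /andP[lei ne_ij].
  by apply/eqP; rewrite eqb0; apply: contraNN ne_ij => di; apply/eqP/uniq.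
by rewrite big1 // => j lej; move: (none j); rewrite lej /= => ->.
Qed.

(** The solution is n * v^-1 modulo u, with the inverse taken from a Bezout
    relation; [u * v <= n] ensures that it satisfies the side condition. *)
Lemma sum_dvdn_sub_eq1 u v n : 0 < u -> coprime u v -> u * v <= n ->
  \sum_(j < u | j * v <= n) (u %| n - j * v) = 1.
Proof.
move=> u_gt0 co_uv le_n; apply/eqP; rewrite eqn_leq sum_dvdn_sub_le1 //=.
have v_or : (0 < v) || (u == 1).
  by case: v co_uv {le_n} => //; rewrite /coprime gcdn0.
have [x dx] : exists x, v * x = 1 %[mod u].
  (* If v = 0, then u = 1 and every congruence modulo u holds. *)
  case: (posnP v) v_or => [-> /= /eqP ->|v_gt0 _]; first by exists 0; rewrite !modn1.
  case: (egcdnP u v_gt0) => x y e _; exists x.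
  by rewrite mulnC e gcdnC (eqP co_uv) modnMDl.
pose j := Ordinal (ltn_pmod (n * x) u_gt0).
have lej : j * v <= n by rewrite (leq_trans _ le_n) // leq_mul2r ltnW ?orbT.
rewrite (bigD1 j) //= -[X in X <= _]/(nat_of_bool true) -eqn_mod_dvd //.
rewrite modnMml -mulnA (mulnC x) -modnMmr dx modnMmr muln1 eqxx.
exact: leq_addr.
Qed.

(** The count increases by exactly 1 when n increases by A 0 * A 1, and is at
    most 1 below A 0 * A 1. *)
Lemma part_count2_bounds A n : (forall i, 0 < A i) -> coprime (A 0) (A 1) ->
  n - A 0 * A 1 <= A 0 * A 1 * part_count A n 2 <= n + A 0 * A 1.
Proof.
move=> A_pos co; elim/ltn_ind: n => n IHn.
rewrite (@part_count2_iter A n (A 0)) //.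
have [le_n|gt_n] := leqP (A 0 * A 1) n; last first.
  have := sum_dvdn_sub_le1 n co; set S := bigop _ _ _ => S1.
  rewrite addn0; apply/andP; split; first lia.
  by rewrite (leq_trans (leq_mul (leqnn _) S1)) // muln1 leq_addl.
rewrite sum_dvdn_sub_eq1 // mulnDr muln1.
have m_gt0 : 0 < A 0 * A 1 by rewrite muln_gt0 !A_pos.
have /IHn : n - A 0 * A 1 < n by lia.
by case/andP => lo hi; apply/andP; split; lia.
Qed.

(** * Polynomial bounds for the number of partitions *)

(** The integral of (r + 1) * t ^ r over [y, y + h] is at least h times the
    value of the integrand at the left end. *)
Lemma expn_step_upper r h y : y ^ r.+1 + r.+1 * h * y ^ r <= (y + h) ^ r.+1.
Proof.
elim: r => [|r IHr]; first by rewrite !expn1 mul1n expn0 muln1.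
rewrite [X in _ <= X]expnS; apply: leq_trans (leq_mul (leqnn (y + h)) IHr).
by rewrite !expnS; set z := y ^ r; nia.
Qed.

(** The integral of (r + 1) * t ^ r over [x - h, x] is at most h times the
    value of the integrand at the right end. Truncation does no harm: for
    x < h the interval becomes [0, x], of length less than h. *)
Lemma expn_step_lower r h x : x ^ r.+1 <= (x - h) ^ r.+1 + r.+1 * h * x ^ r.
Proof.
elim: r => [|r IHr]; first by rewrite !expn1 mul1n expn0 muln1; lia.
have le_r : (x - h) ^ r.+1 <= x ^ r.+1 by rewrite leq_exp2r // leq_subr.
have le_x : x <= (x - h) + h by lia.
rewrite [X in X <= _]expnS (leq_trans (leq_mul (leqnn x) IHr)) //.
rewrite mulnDr (expnS _ r.+1).
have : x * (x - h) ^ r.+1 <= (x - h) * (x - h) ^ r.+1 + h * x ^ r.+1.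
  rewrite (leq_trans (leq_mul le_x (leqnn _))) // mulnDl leq_add2l.
  by rewrite leq_mul2l le_r orbT.
by rewrite !(expnS x) => ?; set z := x ^ r in le_r *; nia.
Qed.

(** The shift A 0 * A 1 is inherited unchanged from the case of two parts,
    since a new part h costs one application of [expn_step_lower] at
    x = n - A 0 * A 1 for each copy of h. *)
Lemma part_count_ge A k n : (forall i, 0 < A i) -> coprime (A 0) (A 1) ->
  (n - A 0 * A 1) ^ k.+1 <=
    (k.+1)`! * (\prod_(i < k.+2) A i) * part_count A n k.+2.
Proof.
move=> A_pos co; elim: k n => [|k IHk] n.
  have /andP[lo _] := part_count2_bounds n A_pos co.
  by rewrite expn1 mul1n !big_ord_recr big_ord0 /= mul1n.
rewrite big_ord_recr factS /=; set P := bigop _ _ _.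
elim/ltn_ind: n => n IHn; rewrite part_countS //.
set h := A k.+2; set m := A 0 * A 1.
have h_gt0 : 0 < h := A_pos _.
apply: (leq_trans (expn_step_lower k.+1 h _)).
rewrite mulnDr addnC; apply: leq_add.
  have -> : k.+2 * k.+1`! * (P * h) * part_count A n k.+2 =
    k.+2 * h * (k.+1`! * P * part_count A n k.+2) by lia.
  by rewrite leq_mul2l IHk orbT.
have [le_n|gt_n] := leqP h n.
  by rewrite subnAC IHn // ltn_subrL h_gt0 (leq_trans h_gt0).
by rewrite subnAC (eqP (ltnW gt_n)) sub0n exp0n.
Qed.

(** The natural shift of n is A 0 * A 1 + A 2 + ... + A (k + 1), each new part
    adding itself to the shift.  It is replaced by the product of the parts,
    which is larger because all of the factors A 0 * A 1, A 2, ... are at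
    least 2. *)
Lemma part_count_le A k n : (forall i, 0 < A i) -> (forall i, 0 < i -> 1 < A i) ->
  coprime (A 0) (A 1) ->
  (k.+1)`! * (\prod_(i < k.+2) A i) * part_count A n k.+2 <=
    (n + \prod_(i < k.+2) A i) ^ k.+1.
Proof.
move=> A_pos A_gt1 co; elim: k n => [|k IHk] n.
  have /andP[_ hi] := part_count2_bounds n A_pos co.
  by rewrite expn1 mul1n !big_ord_recr big_ord0 /= mul1n.
have P_gt1 : 1 < \prod_(i < k.+2) A i.
  rewrite big_ord_recr /= (leq_trans (A_gt1 k.+1 isT)) // leq_pmull //.
  by rewrite prodn_gt0.
rewrite big_ord_recr factS /=; move: P_gt1 IHk; set P := bigop _ _ _ => P_gt1 IHk.
set h := A k.+2.
have h_gt1 : 1 < h by apply: A_gt1.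
(* The induction on n needs the sharper shift P + h: the term n - h of the
   recurrence must give back (n + P) ^ k.+2. *)
suff {n} bound n : k.+2 * k.+1`! * (P * h) * part_count A n k.+3 <=
    (n + P + h) ^ k.+2.
  by rewrite (leq_trans (bound n)) // leq_exp2r // -addnA leq_add2l; nia.
elim/ltn_ind: n => n IHn; rewrite part_countS // -/h.
apply: (leq_trans _ (expn_step_upper k.+1 h _)).
rewrite mulnDr addnC; apply: leq_add.
  have [le_n|_] := leqP h n; last by rewrite muln0.
  have lt_n : n - h < n by lia.
  apply: leq_trans (IHn _ lt_n) _.
  by rewrite leq_exp2r //; lia.
have -> : k.+2 * k.+1`! * (P * h) * part_count A n k.+2 =
  k.+2 * h * (k.+1`! * P * part_count A n k.+2) by lia.
by rewrite leq_mul2l IHk orbT.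
Qed.

(** * Comparing the bounds *)

(** For a <= b, split 3 between the factors: a + b + P <= 3 (b - m), and
    a - m >= 3 * (N / 2) with (N / 2) ^ s > N. The last inequality needs an
    exponent of at least 2, hence three parts. *)
Lemma expn_product_dominates s m P N a b :
  1 < s -> m <= P -> 6 <= P -> 2 * P <= N -> 2 * N + 2 <= a -> 2 * N + 2 <= b ->
  N * (a + b + P) ^ s < ((a - m) * (b - m)) ^ s.
Proof.
move=> s_gt1 mP P6 PN; wlog le_ab : a b / a <= b.
  move=> W aN bN; case/orP: (leq_total a b) => /W; first exact.
  by rewrite [b + a]addnC [(b - m) * _]mulnC; apply.
move=> aN bN.
have sum_le : a + b + P <= 3 * (b - m) by lia.
have x_ge : 3 * N./2 <= a - m by lia.
have N_lt : N < N./2 ^ s.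
  have : N < N./2 ^ 2 by rewrite -mulnn; nia.
  by move/leq_trans; apply; rewrite leq_exp2l //; lia.
have y_gt0 : 0 < (3 * (b - m)) ^ s by rewrite expn_gt0; lia.
apply: (@leq_ltn_trans (N * (3 * (b - m)) ^ s)).
  by rewrite leq_mul2l leq_exp2r ?sum_le ?orbT //; lia.
apply: (@leq_trans (N./2 ^ s * (3 * (b - m)) ^ s)); first by rewrite ltn_pmul2r.
by rewrite -expnMn leq_exp2r; [rewrite mulnCA mulnA leq_mul2r x_ge orbT|lia].
Qed.

Theorem theorem3p4 (A : nat -> nat)
    (A_pos : forall i : nat, 0 < A i)
    (A_incr : forall i j : nat, i < j -> A i < A j)
    (A_coprime : gcdn (A 0) (A 1) = 1)
    (k : nat) (k_ge3 : 3 <= k)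
    (a b : nat)
    (a_large : 2 * (k.-1)`! * (\prod_(i < k) A i) + 2 <= a)
    (b_large : 2 * (k.-1)`! * (\prod_(i < k) A i) + 2 <= b) :
  part_count A (a + b) k < part_count A a k * part_count A b k.
Proof.
have co : coprime (A 0) (A 1) by rewrite /coprime A_coprime.
have A_gt1 i : 0 < i -> 1 < A i.
  by move=> /A_incr; apply: leq_ltn_trans.
have [r def_k] : exists r, k = r.+3 by exists (k - 3); lia.
subst k; move: a_large b_large; rewrite -!(mulnA 2) => aN bN.
have lo := @part_count_ge A r.+1 _ A_pos co.
have hi := part_count_le r.+1 (a + b) A_pos A_gt1 co.
have [m_le P_ge6] :
    A 0 * A 1 <= \prod_(i < r.+3) A i /\ 6 <= \prod_(i < r.+3) A i.
  rewrite 3!big_ord_recl /= /bump /=.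
  have : 0 < \prod_(i < r) A (1 + (1 + (1 + i))) by rewrite prodn_gt0.
  have := A_pos 0; have := A_incr 0 1 isT; have := A_incr 1 2 isT.
  set Q := bigop _ _ _ => A12 A01 A00 Q0.
  rewrite !mulnA; split.
    by rewrite -mulnA leq_pmulr // muln_gt0 A_pos.
  have A1_ge2 : 2 <= A 1 by lia.
  have A2_ge3 : 3 <= A 2 by lia.
  exact: leq_mul (leq_mul (leq_mul A00 A1_ge2) A2_ge3) Q0.
move: lo hi m_le P_ge6 aN bN; set P := bigop _ _ _ => lo hi m_le P_ge6.
have fact_ge2 : 2 <= (r.+2)`!.
  by rewrite (leq_trans _ (fact_geq _)).
rewrite -[r.+3.-1]/(r.+2); set N := (r.+2)`! * P => aN bN.
have PN : 2 * P <= N by rewrite leq_mul2r fact_ge2 orbT.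
have N_gt0 : 0 < N by lia.
have dom := expn_product_dominates (isT : 1 < r.+2) m_le P_ge6 PN aN bN.
(* Both sides are multiplied by N ^ 2, one factor N for each count on the
   right. *)
rewrite -(ltn_pmul2l N_gt0) -(ltn_pmul2l N_gt0).
apply: (leq_ltn_trans (leq_mul (leqnn N) hi)).
apply: (leq_trans dom); rewrite expnMn.
apply: leq_trans (leq_mul (lo a) (lo b)) _.
by rewrite -/N [X in _ <= X]mulnA (mulnACA N N).
Qed.
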